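(* Let $\lambda$ be an infinite cardinal number such that $\lambda=\lambda^{\aleph_0}$. Then for every metric space $X$ of weight $\lambda$ there exist a Hausdorff compact space $K$ and a bijective continuous mapping from $X$ onto $K$.
   Context: The weight of a topological space is the least cardinality of a base of its topology; the weight of a metric space is the weight of the topology induced by its metric. *)

(* Defs.v *)
From HB Require Import structures.
From mathcomp Require Import all_boot all_order all_algebra.
From mathcomp Require Import all_classical all_reals all_analysis.

Set Implicit Arguments.
Unset Strict Implicit.
Unset Printing Implicit Defensive.

Local Open Scope classical_set_scope.
Local Open Scope card_scope.

(* A cardinal number is represented by a type [L], standing for the
   cardinality of [L]; the weight is then compared to it up to equipotence. *)
Definition has_weight (T : topologicalType) (L : Type) : Prop :=
  (exists B : set (set T), basis B /\ B #= [set: L]) /\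
  (forall B : set (set T), basis B -> [set: L] #<= B).

(* Main.v *)
(** The compact space is the power [H^(nat * nat)] of the compact hedgehog
    [H] with one spine per point of [X]: the one-point compactification of
    [X * ]0, 1]], realised inside [[0, 1]^X] as the functions with at most one
    nonzero value. Since [lambda = lambda ^ aleph_0], it has as many points as
    [X], and [X] contains a uniformly separated set of [lambda] points [h n a],
    [n : nat], [a : X]. A Stone-type argument gives countably many continuous
    maps [phi i : X -> H] that separate points.

    Whatever target [k] is prescribed for the point [d = h n a], the map
    [tube d k] takes [d] to [k], moves coordinates one after the other from [k]
    to a coding of the argument (its distance to [d], its values under [phi])
    and of the label [d], and forgets [k] and [d] at the boundary of a ball
    around [d]. The image of the punctured ball thus consists of points in which
    the label [d] is eventually visible. Stage [0] sends the points [h 0 a]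
    bijectively to the unlabelled points of [H^(nat * nat)] that are not yet
    covered, and stage [n + 1] sends the points [h n.+1 a] bijectively to the
    not yet covered points with a label among the [h n a]; glueing all the tubes
    yields the bijection. *)
Require Import Defs.
From mathcomp Require Import all_boot all_order all_algebra.
From mathcomp Require Import all_classical all_reals all_analysis.
From mathcomp Require Import lra wochoice.

Set Implicit Arguments.
Unset Strict Implicit.
Unset Printing Implicit Defensive.

Import Order.TTheory GRing.Theory Num.Theory.
Import numFieldNormedType.Exports.

Local Open Scope classical_set_scope.
Local Open Scope card_scope.
Local Open Scope ring_scope.

(** * Cardinal comparison through injections *)

Lemma card_le_inj (T U : Type) (B : set U) :
  [set: T] #<= B -> exists f : T -> U, injective f /\ forall x, B (f x).
Proof.
move=> /card_leP[f].
exists (fun x => val (f (SigSub (in_setT x)))); split; last first.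
  by move=> x; apply: set_valP.
move=> x y /val_inj /(@inj _ _ _ f) => /(_ (in_setT _) (in_setT _)).
by move=> /(congr1 val).
Qed.

Lemma inj_card_leT (T U : Type) (B : set U) (f : T -> U) :
  injective f -> (forall x, B (f x)) -> [set: T] #<= B.
Proof.
move=> fi fB; have : f @` [set: T] #= [set: T].
  by apply: inj_card_eq => x y _ _; exact: fi.
rewrite card_eq_sym card_eq_le => /andP[h _].
by apply: (card_le_trans h); apply: subset_card_le => _ [x _ <-].
Qed.

Lemma card_leT_inj (T U : Type) :
  [set: T] #<= [set: U] -> exists f : T -> U, injective f.
Proof. by move=> /card_le_inj[f [fi _]]; exists f. Qed.

Lemma Cantor_Bernstein_enum (T U : Type) (A : set U) :
  [set: T] #<= A -> A #<= [set: T] ->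
  exists f : T -> U, injective f /\ range f = A.
Proof.
move=> TA AT; have /card_bijP[f fb] : [set: T] #= A.
  by rewrite card_eq_le TA AT.
exists (fun x => val (f (SigSub (in_setT x)))); split.
  by move=> x y /val_inj /(bij_inj fb) /(congr1 val).
apply/seteqP; split=> [_ [x _ <-]|u Au]; first exact: set_valP.
case: (fb) => g fK gK; exists (val (g (SigSub (mem_set Au)))) => //.
set y := g _; have -> : SigSub (in_setT (val y)) = y by apply: val_inj.
by rewrite gK.
Qed.

(** * Sets at least as large as their countable power *)

Section power.
Variable X : Type.
Hypothesis pow_le : [set: nat -> X] #<= [set: X].
Hypothesis nat_le : [set: nat] #<= [set: X].

Lemma card_le_prodX : [set: X * X] #<= [set: X].
Proof.
apply: card_le_trans pow_le.
apply: (@inj_card_leT _ _ _ (fun p n => if n is 0%N then p.1 else p.2)) => //.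
move=> [a b] [a' b'] /= e.
by move: (congr1 (@^~ 0%N) e) (congr1 (@^~ 1%N) e) => /= -> ->.
Qed.

Lemma card_le_prod (T U : Type) : [set: T] #<= [set: X] ->
  [set: U] #<= [set: X] -> [set: T * U] #<= [set: X].
Proof.
move=> /card_leT_inj[f fi] /card_leT_inj[g gi].
apply: card_le_trans card_le_prodX.
apply: (@inj_card_leT _ _ _ (fun p => (f p.1, g p.2))) => //.
by move=> [a b] [a' b'] [/fi -> /gi ->].
Qed.

Lemma card_le_pow (T : Type) : [set: T] #<= [set: X] ->
  [set: nat -> T] #<= [set: X].
Proof.
move=> /card_leT_inj[f fi]; apply: card_le_trans pow_le.
apply: (@inj_card_leT _ _ _ (fun u n => f (u n))) => //.
by move=> u v e; apply/funext => n; apply/fi; exact: (congr1 (@^~ n) e).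
Qed.

(** A real is determined by the set of rationals below it, hence by a sequence of zeros and ones
    indexed by the codes of rationals. *)
Lemma card_le_real (R : realType) : [set: R] #<= [set: X].
Proof.
apply: card_le_trans (card_le_pow nat_le).
pose c (x : R) (n : nat) : nat :=
  if unpickle n is Some q then (ratr q < x)%R : nat else 0%N.
apply: (@inj_card_leT _ _ _ c) => // x y e; apply/eqP/negPn/negP.
wlog xy : x y e / x < y => [h|_].
  rewrite neq_lt => /orP[xy|yx]; first by apply: (h x y) => //; rewrite lt_eqF.
  by apply: (h y x) => //; rewrite lt_eqF.
have [q] := rat_in_itvoo xy; rewrite in_itv/= => /andP[xq qy].
have := congr1 (@^~ (pickle q)) e.
by rewrite /c pickleK qy (lt_gtF xq).
Qed.

End power.

(* König's argument: if for every [n] some value is missed by the [n]-th terms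
   of the sequences mapped into [A n], then the sequence of these missed values
   is mapped into no [A n]. *)
Lemma card_le_bigcup_pow (L U : Type) (A : nat -> set U) :
  [set: nat -> L] #<= \bigcup_n A n -> exists n, [set: L] #<= A n.
Proof.
move=> /card_le_inj[g [gi gA]].
have [[n hn]|h] := pselect (exists n, forall a,
    exists2 u : nat -> L, u n = a & A n (g u)).
  exists n; have [s hs] := choice (fun a => let: ex_intro2 u p q := hn a in
    ex_intro (fun u => u n = a /\ A n (g u)) u (conj p q)).
  apply: (@inj_card_leT _ _ _ (g \o s)) => [a b /gi e|a].
    by have [<- _] := hs a; have [<- _] := hs b; rewrite e.
  by have [] := hs a.
have {}h n : exists a, forall u : nat -> L, u n = a -> ~ A n (g u).
  apply: contrapT => /forallNP h'; apply: h; exists n => a.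
  by apply: contrapT => h''; apply: (h' a) => u un Au; apply: h''; exists u.
have [u hu] := choice h.
by have [n _ /(hu n u erefl)] := gA u.
Qed.

(** * Positive parts of real functions *)

Section pos.
Variable R : realType.
Implicit Types x y : R.

Definition pos x := Num.max 0 x.

Lemma pos_ge0 x : 0 <= pos x.
Proof. by rewrite le_max lexx. Qed.

Lemma le_pos x : x <= pos x.
Proof. by rewrite le_max lexx orbT. Qed.

Lemma pos_le x y : 0 <= y -> x <= y -> pos x <= y.
Proof. by move=> y0 xy; rewrite ge_max y0 xy. Qed.

Lemma pos_eq0 x : x <= 0 -> pos x = 0.
Proof. exact: max_l. Qed.

Lemma pos_id x : 0 <= x -> pos x = x.
Proof. exact: max_r. Qed.

Lemma continuous_pos (T : topologicalType) (w : T -> R) : continuous w ->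
  continuous (fun t => pos (w t)).
Proof.
move=> wc t; apply: (@continuous_max R T (fun=> 0) w) => //; last exact: wc.
exact: cvg_cst.
Qed.

End pos.

(** * Separated nets and the weight of a metric space *)

Section metric.
Variables (R : realType) (X : metricType R).
Implicit Types (x y a b : X) (r : R).

Definition dist x y : R := mdist x y.

Lemma dist_ge0 x y : 0 <= dist x y. Proof. exact: mdist_ge0. Qed.

Lemma distxx x : dist x x = 0. Proof. exact: mdistxx. Qed.

Lemma dist_eq0 x y : dist x y = 0 -> x = y.
Proof. exact: mdist_positivity. Qed.

Lemma dist_sym x y : dist x y = dist y x. Proof. exact: metric_sym. Qed.

Lemma dist_triangle x y z : dist x z <= dist x y + dist y z.
Proof. exact: metric_triangle. Qed.

Lemma ball_distE x r : ball x r = [set y | dist x y < r].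
Proof. exact: ballEmdist. Qed.

Lemma nbhs_distP x (U : set X) :
  nbhs x U <-> exists2 r : R, 0 < r & forall y, dist x y < r -> U y.
Proof.
split=> [/nbhs_ballP[r /= r0 rU]|[r r0 rU]].
  by exists r => // y xy; apply: rU; rewrite ball_distE.
by apply/nbhs_ballP; exists r => // y; rewrite ball_distE; exact: rU.
Qed.

Lemma open_ball x r : open (ball x r).
Proof.
rewrite openE => y; rewrite ball_distE /= => xy.
apply/nbhs_distP; exists (r - dist x y); first by rewrite subr_gt0.
move=> z yz /=.
by have := dist_triangle x y z; lra.
Qed.

Lemma invn_lt r : 0 < r -> exists n : nat, n.+1%:R^-1 < r.
Proof.
move=> r0; have [n _ h] := near_infty_natSinv_lt (PosNum r0).
by exists n; exact: (h n (leqnn n)).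
Qed.

(** Zorn gives a maximal [r]-separated set; a point at distance at least [r] from all its members
    could be added to it. *)
Lemma separated_net r : 0 < r -> exists D : set X,
  (forall a b, D a -> D b -> a <> b -> r <= dist a b) /\
  (forall x, exists a, D a /\ dist a x < r).
Proof.
move=> r0.
pose P := [set D : set X | forall a b, D a -> D b -> a <> b -> r <= dist a b].
have [|D [PD Dmax]] := @Zorn_bigcup X P.
  move=> F FP Ftot a b [A FA Aa] [B FB Bb].
  have [/(_ a Aa) Ba|/(_ b Bb) Ab] := Ftot A B FA FB.
    exact: (FP B).
  exact: (FP A).
exists D; split => // x; apply: contrapT => /forallNP h.
have hx a : D a -> r <= dist a x.
  by move=> Da; rewrite leNgt; apply/negP => ax; apply: (h a).
apply: (Dmax (x |` D)).
  split=> [a Da|/(_ x (or_introl erefl)) Dx]; first by right.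
  by have := hx x Dx; rewrite distxx; lra.
move=> a b [->|Da] [->|Db] // ab; [rewrite dist_sym| |]; auto.
Qed.

(** The [q n]-balls around [q n]-separated nets, for all [n], form a base, so there are at least
    $\lambda=\lambda^{\aleph_0}$ of them. König's argument then puts $\lambda$ of them at a single
    scale [n], whose net is the required separated set. *)
Lemma weight_le_separated (L : Type) : [set: L] #= [set: nat -> L] ->
  has_weight X L -> exists r (g : L -> X),
  [/\ 0 < r, injective g & forall l m, l <> m -> r <= dist (g l) (g m)].
Proof.
move=> Lpow [_ wmin].
pose q (n : nat) : R := n.+1%:R^-1.
have q0 n : 0 < q n by rewrite invr_gt0.
have [D hD] := choice (fun n => separated_net (q0 n)).
pose A n := (fun a => ball a (q n)) @` D n.
have Abase : basis (\bigcup_n A n).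
  split=> [_ [n _ [a _ <-]]|x U /nbhs_distP[e e0 eU]]; first exact: open_ball.
  have [n ne] : exists n, q n < e / 2.
    by apply: invn_lt; rewrite divr_gt0.
  have [_ /(_ x)[a [Da ax]]] := hD n.
  exists (ball a (q n)).
    by split; [exists n => //; exists a|rewrite ball_distE].
  move=> z /=; rewrite ball_distE /= => az; apply: eU.
  have := dist_triangle x a z; rewrite (dist_sym x a); lra.
have : [set: nat -> L] #<= \bigcup_n A n.
  apply: card_le_trans (wmin _ Abase).
  by move: Lpow; rewrite card_eq_le => /andP[].
move=> /card_le_bigcup_pow[n LA].
have /card_le_inj[g [gi gD]] := card_le_trans LA (card_image_le _ _).
exists (q n), g; split=> // l m lm.
by apply: (hD n).1 => // /gi.
Qed.

(** A point is determined by a sequence of basic neighbourhoods shrinking to it, so there are at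
    most $\lambda^{\aleph_0}=\lambda$ points. *)
Lemma card_le_weight (L : Type) : [set: L] #= [set: nat -> L] ->
  has_weight X L -> [set: X] #<= [set: L].
Proof.
move=> Lpow [[B [[_ Bbase] BL]] _].
pose q (n : nat) : R := n.+1%:R^-1.
have [e [ei eB]] : exists e : L -> set X, injective e /\ range e = B.
  by apply: Cantor_Bernstein_enum; move: BL; rewrite card_eq_le => /andP[].
have h (p : X * nat) : exists l, e l p.1 /\ e l `<=` ball p.1 (q p.2).
  have [|U [BU Ux] Ub] := Bbase p.1 (ball p.1 (q p.2)).
    by apply: nbhsx_ballx; rewrite invr_gt0.
  by move: BU; rewrite -eB => -[l _ lU]; exists l; rewrite lU.
have [l hl] := choice h.
have : [set: nat -> L] #<= [set: L].
  by move: Lpow; rewrite card_eq_le => /andP[].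
apply: card_le_trans.
apply: (@inj_card_leT _ _ _ (fun x n => l (x, n))) => // x y exy.
apply: dist_eq0; apply/eqP/negPn/negP => xy.
have [n] : exists n, q n < dist x y.
  by apply: invn_lt; rewrite lt_neqAle eq_sym xy dist_ge0.
have [ey _] := hl (y, n); have [_] := hl (x, n).
have -> : l (x, n) = l (y, n) by exact: (congr1 (@^~ n) exy).
by move=> /(_ y ey); rewrite ball_distE /=; lra.
Qed.

Lemma lipschitz1_continuous (w : X -> R) :
  (forall x y, w x <= w y + dist x y) -> continuous w.
Proof.
move=> h x; apply/cvgrPdist_lt => e e0; apply/nbhs_distP; exists e => //= y xy.
have := h x y; have := h y x.
by rewrite (dist_sym y x) ltr_norml; lra.
Qed.

Lemma dist_continuous a : continuous (dist a : X -> R).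
Proof.
apply: lipschitz1_continuous => x y.
by have := dist_triangle a y x; rewrite (dist_sym y x).
Qed.

(** * Stone-type maps into the hedgehog *)

Definition hedgehog : set (X -> R) :=
  [set w | (forall a, 0 <= w a <= 1) /\
           (forall a b, w a <> 0 -> w b <> 0 -> a = b)].

Section ordered_cover.
Variables (W : rel X) (r s : R).
Hypothesis (Wtot : forall a b, a <> b -> W a b \/ W b a).
Hypotheses (r0 : 0 < r) (r1 : r <= 1) (s0 : 0 < s) (s1 : s <= 1).

Definition bump a x : R := pos (r - dist a x).

(** The value 0 keeps the set nonempty when nothing precedes [a]. *)
Definition bump_below a x : R :=
  sup [set t | t = 0 \/ exists b, [/\ b <> a, W b a & t = bump b x]].

(** A continuous substitute for the indicator of [a] being the first centre near [x]: the bump of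
    [a] must exceed the threshold [s] while all earlier bumps stay below it. *)
Definition first_bump x a : R := pos (bump a x - s) * pos (s - bump_below a x).

Lemma bump_le1 a x : bump a x <= 1.
Proof. by apply: pos_le => //; have := r1; have := dist_ge0 a x; lra. Qed.

Lemma bump_lip a x y : bump a x <= bump a y + dist x y.
Proof.
have := dist_triangle a x y; have := dist_ge0 x y; rewrite /bump.
have := pos_ge0 (r - dist a y); have := le_pos (r - dist a y).
by move=> h1 h2 h3 h4; apply: pos_le; lra.
Qed.

Lemma bump_below_ub a x :
  has_ubound [set t | t = 0 \/ exists b, [/\ b <> a, W b a & t = bump b x]].
Proof. by exists 1 => _ [->|[b [_ _ ->]]] //; exact: bump_le1. Qed.

Lemma bump_below_ge0 a x : 0 <= bump_below a x.
Proof. by apply: (ub_le_sup (bump_below_ub a x)); left. Qed.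

Lemma bump_le_below a b x : b <> a -> W b a -> bump b x <= bump_below a x.
Proof.
by move=> ba Wba; apply: (ub_le_sup (bump_below_ub a x)); right; exists b.
Qed.

(** A supremum of 1-Lipschitz functions is 1-Lipschitz, so continuity needs no local finiteness of
    the cover. *)
Lemma bump_below_lip a x y : bump_below a x <= bump_below a y + dist x y.
Proof.
apply: ge_sup; first by exists 0; left.
move=> _ [->|[b [ba Wba ->]]].
  by rewrite addr_ge0 ?bump_below_ge0 ?dist_ge0.
by have := bump_lip b x y; have := bump_le_below y ba Wba; lra.
Qed.

Lemma first_bump_continuous a : continuous (first_bump^~ a).
Proof.
move=> x; apply: cvgM; move: x; apply: continuous_pos => x.
  apply: cvgB; last exact: cvg_cst.
  exact: (lipschitz1_continuous (bump_lip a)).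
apply: cvgB; first exact: cvg_cst.
exact: (lipschitz1_continuous (bump_below_lip a)).
Qed.

(* If [a] precedes [b] and [first_bump x a] is nonzero, then [s < bump a x], so
   [s < bump_below b x] and [first_bump x b] vanishes. *)
Lemma first_bump_hedgehog x : hedgehog (first_bump x).
Proof.
split=> [a|a b].
  apply/andP; split; first by rewrite mulr_ge0 ?pos_ge0.
  apply: mulr_ile1; rewrite ?pos_ge0 //; apply: pos_le => //.
    by have := s0; have := bump_le1 a x; lra.
  by have := s1; have := bump_below_ge0 a x; lra.
wlog Wab : a b / W a b.
  move=> h an bn; have [//|ab] := pselect (a = b).
  by have [|] := Wtot ab => Wab; [exact: h|symmetry; exact: h].
have [//|ab] := pselect (a = b).
rewrite /first_bump => an bn; exfalso.
have sa : s < bump a x.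
  have [sa|//] := lerP (bump a x) s; exfalso; apply: an.
  by rewrite (pos_eq0 (_ : bump a x - s <= 0)) ?mul0r //; lra.
have := bump_le_below x ab Wab => ?; apply: bn.
by rewrite [X in _ * X]pos_eq0 ?mulr0 //; lra.
Qed.

Lemma first_bump_near x a : first_bump x a <> 0 -> dist a x < r.
Proof.
have [rx h|//] := lerP r (dist a x); exfalso; apply: h.
rewrite /first_bump /bump (pos_eq0 (_ : r - _ <= 0)); last by lra.
by rewrite pos_eq0 ?mul0r //; have := s0; lra.
Qed.

Lemma first_bump_least x a : s < r - dist a x ->
  (forall b, dist b x < r -> W a b) ->
  (forall a b, W a b -> W b a -> a = b) -> first_bump x a <> 0.
Proof.
move=> sx amin anti.
have v0 : bump_below a x <= 0.
  apply: ge_sup; first by exists 0; left.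
  move=> _ [->//|[b [ba Wba ->]]]; apply: pos_le => //.
  by rewrite subr_le0 leNgt; apply/negP => bx; apply/ba/anti/amin.
have := le_pos (r - dist a x); have := le_pos (bump a x - s).
have := le_pos (s - bump_below a x).
rewrite -/(bump a x); have := s0 => h0 h1 h2 h3.
by apply/eqP; rewrite mulf_neq0 // gt_eqF //; lra.
Qed.

End ordered_cover.

Lemma hedgehog_embedding : exists phi : nat -> X -> X -> R,
  [/\ forall i a, continuous (fun x => phi i x a),
      forall i x, hedgehog (phi i x) &
      forall x y, (forall i a, phi i x a = phi i y a) -> x = y].
Proof.
have [W Wwo] := well_ordering_principle X.
have minP (P : pred X) x : P x -> exists2 a, P a & forall b, P b -> W a b.
  move=> Px; have [|a [[Pa amin] _]] := Wwo P; first by exists x.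
  by exists a => // b; exact: amin.
have Wtot a b : a <> b -> W a b \/ W b a.
  move=> _; have [|c /orP[]/eqP -> h] := minP (fun z => (z == a) || (z == b)) a.
  - by rewrite eqxx.
  - by left; apply: h; rewrite eqxx orbT.
  - by right; apply: h; rewrite eqxx.
(* If [W] holds both ways, [a] and [b] are both least in the pair, and least elements are unique. *)
have Wanti a b : W a b -> W b a -> a = b.
  move=> Wab Wba; have [|c [[cab cmin] cuniq]] := Wwo (pred2 a b).
    by exists a; rewrite inE eqxx.
  have Waa z : W z z.
    have [//|d /eqP -> h] := minP (pred1 z) z; first exact: eqxx.
    by apply: h; rewrite /= eqxx.
  transitivity c; [symmetry|]; apply: cuniq; split; rewrite ?inE ?eqxx ?orbT //;
    by move=> z; rewrite !inE => /orP[]/eqP ->.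
pose d (i : nat) : nat * nat := odflt (0%N, 0%N) (unpickle i).
pose q (n : nat) : R := n.+1%:R^-1.
have q0 n : 0 < q n by rewrite invr_gt0.
have q1 n : q n <= 1 by rewrite invf_le1 ?ltr0n // ler1n.
exists (fun i => first_bump W (q (d i).1) (q (d i).2)); split.
- by move=> i a; exact: first_bump_continuous.
- by move=> i x; exact: first_bump_hedgehog.
move=> x y exy; apply: dist_eq0; apply/eqP/negPn/negP => xy.
have xy0 : 0 < dist x y by rewrite lt_neqAle eq_sym xy dist_ge0.
have [m hm] : exists m : nat, q m < dist x y / 2 by apply: invn_lt; lra.
have [|a /= ax amin] := minP (fun a => dist a x < q m) x.
  by rewrite distxx.
have [n hn] : exists n, q n < q m - dist a x.
  by apply: invn_lt; rewrite subr_gt0.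
have := exy (pickle (m, n)) a; rewrite /d pickleK /= => e.
have := first_bump_least (q0 n) hn amin Wanti.
rewrite e => /(first_bump_near (q0 n)).
by have := dist_triangle x a y; rewrite (dist_sym x a); lra.
Qed.

End metric.

(** * The countable power of the hedgehog *)

Section hedgehog_power.
Variables (R : realType) (X : metricType R).
Implicit Types (x y a b d : X) (m n c : nat) (t : R).

Local Notation Z := (nat -> nat -> X -> R).
Implicit Types (z k : Z).

Definition hedgehog_power : set Z := [set z | forall m c, hedgehog (z m c)].

Lemma hedgehog_delta d : hedgehog (fun b => (b == d)%:R : R).
Proof.
split=> [b|a b]; first by case: (b == d); rewrite ?lexx ?ler01.
by case: eqP => // -> _; case: eqP.
Qed.

Lemma hedgehog0 : hedgehog (fun _ : X => 0 : R).
Proof. by split=> // b; rewrite lexx ler01. Qed.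

Lemma hedgehog_scale (u : R) (w : X -> R) : 0 <= u <= 1 -> hedgehog w ->
  hedgehog (fun b => u * w b).
Proof.
move=> /andP[u0 u1] [w01 wu]; split=> [b|a b uwa uwb].
  by have /andP[w0 w1] := w01 b; rewrite mulr_ge0 ?mulr_ile1.
by apply: wu => e; [apply: uwa|apply: uwb]; rewrite e mulr0.
Qed.

(** A point of the hedgehog is coded by a spine and a height; the spine [x0] serves when all values
    are 0. *)
Lemma card_hedgehog_power : [set: nat -> X] #<= [set: X] ->
  [set: nat] #<= [set: X] -> hedgehog_power #<= [set: X].
Proof.
move=> Xpow Xnat.
pose decode (s : nat -> nat -> X * R) : Z :=
  fun m c b => if b == (s m c).1 then (s m c).2 else 0.
have XR : [set: nat -> nat -> X * R] #<= [set: X].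
  do 2 apply: (card_le_pow Xpow).
  by apply: (card_le_prod Xpow) => //; exact: card_le_real.
have sub : hedgehog_power `<=` range decode.
  move=> z zH.
  have [x0 _] : [set: X] !=set0.
    by have [f _] := card_leT_inj Xnat; exists (f 0%N).
  have h (p : nat * nat) : exists a, forall b, z p.1 p.2 b <> 0 -> b = a.
    have [[a za]|none] := pselect (exists a, z p.1 p.2 a <> 0).
      by exists a => b zb; exact: (zH _ _).2 zb za.
    by exists x0 => b zb; case: none; exists b.
  have [s hs] := choice h.
  exists (fun m c => (s (m, c), z m c (s (m, c)))) => //.
  apply/funext => m; apply/funext => c; apply/funext => b; rewrite /decode /=.
  case: eqP => [->//|bs]; apply/eqP/negPn/negP => /eqP zb; apply: bs.
  by apply: (hs (m, c)) => /= /esym.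
apply: card_le_trans (subset_card_le sub) _.
exact: card_le_trans (card_image_le _ _) XR.
Qed.

(** * Tubes: maps with a prescribed value at a centre *)

Variables (phi : nat -> X -> X -> R) (x0 : X) (r : R).
Hypothesis phi_cont : forall i a, continuous (fun x => phi i x a).
Hypothesis phi_hedgehog : forall i x, hedgehog (phi i x).
Hypothesis phi_sep : forall x y, (forall i a, phi i x a = phi i y a) -> x = y.
Hypothesis r_gt0 : 0 < r.

Definition nearness d y : R := pos (1 - dist d y / r).

Lemma nearness01 d y : 0 <= nearness d y <= 1.
Proof.
rewrite pos_ge0 pos_le // lerBlDr lerDl divr_ge0 ?dist_ge0 //.
exact: ltW r_gt0.
Qed.

Lemma nearness_center d : nearness d d = 1.
Proof. by rewrite /nearness distxx mul0r subr0 pos_id. Qed.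

Lemma nearness_far d y : r <= dist d y -> nearness d y = 0.
Proof.
by move=> h; rewrite /nearness pos_eq0 // subr_le0 ler_pdivlMr // mul1r.
Qed.

Lemma nearness_gt0 d y : dist d y < r -> 0 < nearness d y.
Proof.
move=> h; apply: lt_le_trans (le_pos _).
by rewrite subr_gt0 ltr_pdivrMr ?mul1r.
Qed.

Lemma nearness_lt1 d y : 0 < dist d y -> nearness d y < 1.
Proof.
move=> h; have [?|?] := lerP (1 - dist d y / r) 0.
  by rewrite /nearness pos_eq0.
by rewrite /nearness pos_id ?ltW // ltrBlDr ltrDl divr_gt0.
Qed.

Lemma nearness_continuous d : continuous (nearness d).
Proof.
apply: continuous_pos => y; apply: cvgB; first exact: cvg_cst.
by apply: cvgM; [exact: dist_continuous|exact: cvg_cst].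
Qed.

(** The time [t] grows from 0 at the centre to 1 at the boundary of the ball. Row [m] fades from the
    target until time [1/(m+1)], and only then grows towards the content. The two weights are never
    both nonzero, so each row stays in the hedgehog; at any positive time all but finitely many rows
    show the content. *)
Definition target_weight m t : R := pos (1 - t * m.+1%:R).
Definition content_weight m t : R := pos (t - m.+1%:R^-1).

(** Column 0 shows the label [d] and fades out at the boundary. Column 1 sits on the fixed spine
    [x0], so that the scaling factor of a row can be read off. The remaining columns identify
    [y]. *)
Definition content d y c a : R :=
  match c with
  | 0 => nearness d y * (a == d)%:R
  | 1 => (a == x0)%:R
  | i.+2 => phi i y a
  end.

Definition tube d k y : Z := fun m c a =>
  target_weight m (1 - nearness d y) * k m c a +
  content_weight m (1 - nearness d y) * content d y c a.

Lemma target_weight_eq0 m t : m.+1%:R^-1 <= t -> target_weight m t = 0.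
Proof.
by move=> h; rewrite /target_weight pos_eq0 // subr_le0 -ler_pdivrMr // mul1r.
Qed.

Lemma content_weight_eq0 m t : t <= m.+1%:R^-1 -> content_weight m t = 0.
Proof. by move=> h; rewrite /content_weight pos_eq0 // subr_le0. Qed.

Lemma target_weight01 m t : 0 <= t -> 0 <= target_weight m t <= 1.
Proof. by move=> t0; rewrite pos_ge0 pos_le // lerBlDr lerDl mulr_ge0. Qed.

Lemma content_weight01 m t : t <= 1 -> 0 <= content_weight m t <= 1.
Proof.
move=> t1; rewrite pos_ge0 pos_le // lerBlDr (le_trans t1) // lerDl.
by rewrite invr_ge0.
Qed.

Lemma content_hedgehog d y c : hedgehog (content d y c).
Proof.
case: c => [|[|i]].
- exact: hedgehog_scale (nearness01 d y) (hedgehog_delta d).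
- exact: hedgehog_delta.
- exact: phi_hedgehog.
Qed.

Lemma tube_hedgehog d k y : hedgehog_power k -> hedgehog_power (tube d k y).
Proof.
move=> kH m c; rewrite /tube.
have /andP[n0 n1] := nearness01 d y.
set t := 1 - nearness d y.
have [tm|tm] := lerP t m.+1%:R^-1.
  rewrite (_ : (fun _ => _) = (fun a => target_weight m t * k m c a)).
    by apply: hedgehog_scale (kH m c); apply: target_weight01; rewrite subr_ge0.
  by apply/funext => a; rewrite content_weight_eq0 // mul0r addr0.
rewrite (_ : (fun _ => _) = (fun a => content_weight m t * content d y c a)).
  apply: hedgehog_scale (content_hedgehog _ _ _).
  by apply: content_weight01; rewrite lerBlDr lerDl.
by apply/funext => a; rewrite target_weight_eq0 ?ltW // mul0r add0r.
Qed.

Lemma tube_continuous d k m c a : continuous (fun y => tube d k y m c a).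
Proof.
have tc : continuous (fun y => 1 - nearness d y).
  by move=> y; apply: cvgB; [exact: cvg_cst|exact: nearness_continuous].
have wc : continuous (fun y => target_weight m (1 - nearness d y)).
  apply: continuous_pos => y; apply: cvgB; first exact: cvg_cst.
  by apply: cvgM; [exact: tc|exact: cvg_cst].
have vc : continuous (fun y => content_weight m (1 - nearness d y)).
  by apply: continuous_pos => y; apply: cvgB; [exact: tc|exact: cvg_cst].
have cc : continuous (fun y => content d y c a).
  case: c => [|[|i]] y; [|exact: cvg_cst|exact: phi_cont].
  by apply: cvgM; [exact: nearness_continuous|exact: cvg_cst].
move=> y; apply: cvgD; apply: cvgM;
  [exact: wc|exact: cvg_cst|exact: vc|exact: cc].
Qed.

Lemma tube_center d k : tube d k d = k.
Proof.
apply/funext => m; apply/funext => c; apply/funext => a.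
rewrite /tube nearness_center subrr content_weight_eq0 ?invr_ge0 //.
by rewrite mul0r addr0 /target_weight mul0r subr0 pos_id // mul1r.
Qed.

(** At time 1 even row 0 has dropped the target, and column 0 has vanished: no trace of [d] or [k]
    is left. *)
Lemma tube_far d d' k k' y : r <= dist d y -> r <= dist d' y ->
  tube d k y = tube d' k' y.
Proof.
move=> dy dy'; apply/funext => m; apply/funext => c; apply/funext => a.
rewrite /tube !nearness_far // subr0 target_weight_eq0 ?invf_le1 ?ler1n //.
by rewrite !mul0r; case: c => [|[|i]] //=; rewrite !nearness_far // !mul0r.
Qed.

Lemma tube_tail d k y : 0 < dist d y -> exists2 n,
  (n.+1%:R^-1 < 1 - nearness d y) & forall m c a, (n <= m)%N ->
  tube d k y m c a = (1 - nearness d y - m.+1%:R^-1) * content d y c a.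
Proof.
move=> /nearness_lt1; rewrite -subr_gt0 => /invn_lt[n nt].
exists n => // m c a nm.
have mt : m.+1%:R^-1 <= 1 - nearness d y.
  by apply: le_trans (ltW nt); rewrite lef_pV2 ?posrE // ler_nat.
rewrite /tube target_weight_eq0 // mul0r add0r /content_weight.
by rewrite pos_id // subr_ge0.
Qed.

(** * Labels, injectivity of tubes, and markers *)

Definition labelled d : set Z :=
  [set z | exists n, forall m, (n <= m)%N -> z m 0%N d <> 0].

Lemma labelled_uniq d d' z : hedgehog_power z -> labelled d z ->
  labelled d' z -> d = d'.
Proof.
move=> zH [n hn] [n' hn']; apply: (zH (maxn n n') 0%N).2.
  by apply: hn; exact: leq_maxl.
by apply: hn'; exact: leq_maxr.
Qed.

Lemma tube_labelled d k y : 0 < dist d y < r -> labelled d (tube d k y).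
Proof.
move=> /andP[dy0 dyr]; have [n nt tail] := tube_tail k dy0.
exists n => m nm; rewrite tail //= eqxx mulr1; apply/eqP.
rewrite mulf_neq0 // ?gt_eqF ?nearness_gt0 // subr_gt0.
by apply: le_lt_trans nt; rewrite lef_pV2 ?posrE // ler_nat.
Qed.

Lemma tube_far_labelled d d' k y : r <= dist d y -> ~ labelled d' (tube d k y).
Proof.
move=> dy [n /(_ n (leqnn n))]; apply.
rewrite /tube /= nearness_far // subr0 mul0r mulr0 addr0.
by rewrite target_weight_eq0 ?mul0r // invf_le1 // ler1n.
Qed.

Lemma tube_time d k y : 0 < dist d y -> exists m, tube d k y m 1%N x0 <> 0.
Proof.
move=> dy0; have [n nt tail] := tube_tail k dy0.
by exists n; rewrite tail //= eqxx mulr1; apply/eqP; rewrite gt_eqF // subr_gt0.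
Qed.

(** In a row beyond both targets, column 1 gives the common positive factor. Dividing the other
    columns by it recovers all [phi i], which separate points. *)
Lemma tube_inj d d' k k' y y' : 0 < dist d y -> 0 < dist d' y' ->
  tube d k y = tube d' k' y' -> y = y'.
Proof.
move=> dy0 dy0'; have [n nt tail] := tube_tail k dy0.
have [n' nt' tail'] := tube_tail k' dy0' => e.
set m := maxn n n'.
have [nm nm'] : (n <= m)%N /\ (n' <= m)%N by rewrite leq_maxl leq_maxr.
have key c a : (1 - nearness d y - m.+1%:R^-1) * content d y c a =
    (1 - nearness d' y' - m.+1%:R^-1) * content d' y' c a.
  by rewrite -tail // -tail' // e.
have := key 1%N x0; rewrite /= eqxx !mulr1 => t_eq.
apply: phi_sep => i a; have := key i.+2 a; rewrite /= -t_eq; apply: mulfI.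
rewrite gt_eqF // subr_gt0.
by apply: le_lt_trans nt; rewrite lef_pV2 ?posrE // ler_nat.
Qed.

(** These points show that each set of targets is as large as [X]: column 0 carries the wanted label
    or none, column 2 encodes [a], and the zero column 1 keeps them off every tube away from its
    centre. *)
Definition marker (l : option X) a : Z := fun m c b =>
  match c with
  | 0 => if l is Some d then (b == d)%:R else 0
  | 2 => (b == a)%:R
  | _ => 0
  end.

Lemma marker_hedgehog l a : hedgehog_power (marker l a).
Proof.
move=> m [|[|[|c]]]; try exact: hedgehog0; try exact: hedgehog_delta.
case: l => [d|]; [exact: hedgehog_delta|exact: hedgehog0].
Qed.

Lemma marker_inj l : injective (marker l).
Proof.
move=> a b /(congr1 (fun z : Z => z 0%N 2%N a)) /=; rewrite eqxx.
by case: eqP => // _ /eqP; rewrite oner_eq0.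
Qed.

Lemma marker_neq_tube l a d k y : 0 < dist d y -> marker l a <> tube d k y.
Proof. by move=> /tube_time-/(_ k)[m h] e; apply: h; rewrite -e. Qed.

Lemma marker_labelled d a : labelled d (marker (Some d) a).
Proof. by exists 0%N => m _ /=; apply/eqP; rewrite eqxx oner_eq0. Qed.

Lemma marker_unlabelled d a : ~ labelled d (marker None a).
Proof. by move=> [n /(_ n (leqnn n))]; apply. Qed.

(** * Glueing the tubes around separated centres *)

Variable h : nat -> X -> X.
Hypothesis h_inj : forall n a n' a', h n a = h n' a' -> n = n' /\ a = a'.
Hypothesis h_sep : forall n a n' a', h n a <> h n' a' ->
  4 * r <= dist (h n a) (h n' a').
Hypothesis power_le : hedgehog_power #<= [set: X].

Definition far : set X := [set y | forall n a, r <= dist (h n a) y].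

(** By [tube_far], any other centre and target would give the same values on [far]. *)
Definition tube_off : X -> Z := tube (h 0%N x0) (fun _ _ _ => 0).

Definition tube_image d k : set Z :=
  [set tube d k y | y in [set y | 0 < dist d y < r]].

Definition first_targets : set Z := hedgehog_power `&`
  [set z | ~ (tube_off @` far) z /\ forall n a, ~ labelled (h n a) z].

(** Values on [far] carry no label, and a labelled value on a punctured ball names its centre, so
    only the tube with the same label has to be avoided. *)
Definition next_targets n (kap : X -> Z) : set Z := hedgehog_power `&`
  [set z | exists a, labelled (h n a) z /\ ~ tube_image (h n a) (kap a) z].

Lemma far_neq0 y n a : far y -> 0 < dist (h n a) y.
Proof. by move=> /(_ n a); apply: lt_le_trans. Qed.

(* Stage [n] uses the points [h n a] to cover what the labels of stage [n - 1]
   leave out, so the targets of stage [n] may depend on the earlier choices. *)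
Lemma targets : exists kap : nat -> X -> Z,
  [/\ forall n, injective (kap n), range (kap 0%N) = first_targets &
      forall n, range (kap n.+1) = next_targets n (kap n)].
Proof.
have enumP (U : set Z) : exists f : X -> Z,
    U `<=` hedgehog_power -> [set: X] #<= U -> injective f /\ range f = U.
  have [[UH XU]|hU] := pselect (U `<=` hedgehog_power /\ [set: X] #<= U).
    have [f hf] := Cantor_Bernstein_enum XU
      (card_le_trans (subset_card_le UH) power_le).
    by exists f.
  by exists (fun _ _ _ _ => 0) => UH XU; case: hU.
have [enum henum] := choice enumP.
pose kap := nat_rect (fun=> X -> Z) (enum first_targets)
  (fun n kap => enum (next_targets n kap)).
have H0 : injective (kap 0%N) /\ range (kap 0%N) = first_targets.
  apply: henum; first by move=> z [].
  apply: (inj_card_leT (@marker_inj None)) => a.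
  split; first exact: marker_hedgehog.
  split=> [[y yfar /esym]|n b]; last exact: marker_unlabelled.
  by apply: marker_neq_tube; exact: far_neq0.
have HS n : injective (kap n.+1) /\ range (kap n.+1) = next_targets n (kap n).
  apply: henum; first by move=> z [].
  apply: (inj_card_leT (@marker_inj (Some (h n x0)))) => a.
  split; first exact: marker_hedgehog.
  exists x0; split; first exact: marker_labelled.
  by move=> [y /andP[y0 _] /esym]; exact: marker_neq_tube.
exists kap; split; [|exact: H0.2|by move=> n; exact: (HS n).2].
by case=> [|n]; [exact: H0.1|exact: (HS n).1].
Qed.

(** The constant 4 in [h_sep] is 1 + 3; the radius [3 * r] is what the continuity of the glued map
    needs. *)
Lemma center_uniq n a n' a' y : dist (h n a) y < r ->
  dist (h n' a') y < 3 * r -> n = n' /\ a = a'.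
Proof.
move=> ay ay'; apply: h_inj; apply: contrapT => /h_sep.
have := dist_triangle (h n a) y (h n' a'); rewrite (dist_sym y).
by lra.
Qed.

Lemma hedgehog_power_condensation : exists f : X -> Z,
  [/\ injective f, range f = hedgehog_power &
      forall m c a, continuous (fun y => f y m c a)].
Proof.
have [kap [kap_inj kap0 kapS]] := targets.
have fP y : exists z, (forall n a, dist (h n a) y < r ->
    z = tube (h n a) (kap n a) y) /\ (far y -> z = tube_off y).
  have [[n [a ay]]|none] := pselect (exists n a, dist (h n a) y < r).
    exists (tube (h n a) (kap n a) y); split=> [n' a' ay'|/(_ n a)]; last first.
      by rewrite leNgt ay.
    have [|-> -> //] := center_uniq ay (_ : dist (h n' a') y < 3 * r).
    by have := r_gt0; lra.
  exists (tube_off y); split=> // n a ay; case: none; by exists n, a.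
have [f hf] := choice fP.
have f_near y n a (ay : dist (h n a) y < r) := (hf y).1 n a ay.
have f_far y (yfar : far y) := (hf y).2 yfar.
have f_center n a : f (h n a) = kap n a.
  by rewrite (f_near _ n a) ?distxx // tube_center.
have kap_power n a : hedgehog_power (kap n a).
  have : range (kap n) (kap n a) by exists a.
  by case: n => [|n]; rewrite ?kap0 ?kapS => -[].
have trichotomy y : [\/ exists n a, y = h n a,
    exists n a, 0 < dist (h n a) y < r | far y].
  have [[n [a ay]]|none] := pselect (exists n a, dist (h n a) y < r).
    have [->|ny] := pselect (y = h n a); first by apply: Or31; exists n, a.
    apply: Or32; exists n, a; rewrite ay andbT lt_neqAle dist_ge0 andbT eq_sym.
    by apply/eqP => /dist_eq0 /esym.
  apply: Or33 => n a; have [//|ay] := lerP r (dist (h n a) y).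
  by case: none; exists n, a.
(* No target is hit away from the centres. A value on a punctured ball carries the label of its
   centre, so it could only be a target of the next stage, but those avoid this tube image. A value
   on [far] is unlabelled and excluded from stage 0. *)
have kap_new y n a : (forall n a, y <> h n a) -> f y <> kap n a.
  move=> ny e; have kapr : range (kap n) (kap n a) by exists a.
  have [[n' [a' /ny]]//|[n' [a' ay']]|yfar] := trichotomy y.
    have /andP[_ /f_near fy] := ay'.
    have lab := tube_labelled (kap n' a') ay'; rewrite -fy e in lab.
    case: n e lab kapr => [|n] e lab.
      by rewrite kap0 => -[_ [_ /(_ n' a')]].
    rewrite kapS => -[zH [b [blab]]]; apply.
    have [? ?] := h_inj (labelled_uniq zH blab lab); subst n' a'.
    by exists y => //; rewrite -fy.
  have fy := f_far _ yfar; rewrite -e fy in kapr.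
  case: n kapr {e} => [|n].
    by rewrite kap0 => -[_ [+ _]]; apply; exists y.
  by rewrite kapS => -[_ [b [+ _]]]; apply: tube_far_labelled; exact: yfar.
have kap_unlab a n b : ~ labelled (h n b) (kap 0%N a).
  have : range (kap 0%N) (kap 0%N a) by exists a.
  by rewrite kap0 => -[_ [_]]; apply.
have kap_lab n a : exists b, labelled (h n b) (kap n.+1 a).
  have : range (kap n.+1) (kap n.+1 a) by exists a.
  by rewrite kapS => -[_ [b [bl _]]]; exists b.
(* The stage is read off the label: none at stage 0, some [h n b] at stage [n.+1]. *)
have kap_uniq n a n' a' : kap n a = kap n' a' -> n = n' /\ a = a'.
  suff nn : kap n a = kap n' a' -> n = n'.
    by move=> e; split; [exact: nn|move: (e); rewrite -(nn e) => /kap_inj].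
  case: n n' => [|n] [|n'] // e.
  - by have [b] := kap_lab n' a'; rewrite -e => /kap_unlab.
  - by have [b] := kap_lab n a; rewrite e => /kap_unlab.
  - have [b bl] := kap_lab n a; have [b' bl'] := kap_lab n' a'.
    rewrite e in bl.
    by have [-> _] := h_inj (labelled_uniq (kap_power _ _) bl bl').
have noncenter y : (exists n a, y = h n a) \/ (forall n a, y <> h n a) /\
    exists d k, 0 < dist d y /\ f y = tube d k y.
  have [[n [a ->]]|[n [a ay]]|yfar] := trichotomy y; first by left; exists n, a.
  - right; have /andP[ay0 ayr] := ay; split; last first.
      by exists (h n a), (kap n a); rewrite -f_near.
    move=> n' a' e; have [|? ?] := @center_uniq n a n' a' y ayr.
      by rewrite e distxx mulr_gt0.
    by subst n' a'; move: ay0; rewrite e distxx ltxx.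
  - right; split; last first.
      by eexists; eexists; split; last exact: f_far; exact: far_neq0.
    by move=> n a e; have := yfar n a; rewrite e distxx leNgt r_gt0.
exists f; split.
- move=> y y' e.
  have [[n [a ye]]|[ny [d [k [dy fy]]]]] := noncenter y;
  have [[n' [a' ye']]|[ny' [d' [k' [dy' fy']]]]] := noncenter y'.
  + by move: e; rewrite ye ye' !f_center => /kap_uniq[-> ->].
  + by case: (kap_new y' n a ny'); rewrite -e ye f_center.
  + by case: (kap_new y n' a' ny); rewrite e ye' f_center.
  + by apply: (@tube_inj d d' k k' y y') => //; rewrite -fy -fy'.
- apply/seteqP; split=> [_ [y _ <-]|z zH].
    have [[n [a ->]]|[n [a /andP[_ ay]]]|yfar] := trichotomy y.
    + by rewrite f_center.
    + by rewrite (f_near _ _ _ ay); exact: tube_hedgehog.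
    + by rewrite f_far //; apply: tube_hedgehog => m c; exact: hedgehog0.
  (* A point labelled by a centre is in the tube image of that centre or is a target of the next
     stage; any other point comes from [far] or is a target of stage 0. *)
  have [[n [a zl]]|nl] := pselect (exists n a, labelled (h n a) z).
    have [[y yr <-]|zP] := pselect (tube_image (h n a) (kap n a) z).
      by exists y => //; apply: f_near; case/andP: yr.
    have : next_targets n (kap n) z by split => //; exists a.
    by rewrite -kapS => -[b _ <-]; exists (h n.+1 b).
  have [[y yfar <-]|zoff] := pselect ((tube_off @` far) z).
    by exists y => //; exact: f_far.
  have : first_targets z.
    by split=> //; split=> // n a zl; apply: nl; exists n, a.
  by rewrite -kap0 => -[b _ <-]; exists (h 0%N b).
- move=> m c a y.
  (* On the [r]-ball around [y] the map is a single tube. If this ball meets the [r]-ball of a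
     centre, all its points lie within [3 * r] of that centre, which excludes other centres; on
     [far] all tubes agree. *)
  have [n [b loc]] : exists n b, forall y', dist y y' < r ->
      f y' = tube (h n b) (kap n b) y'.
    have [[n [b [y1 [yy1 by1]]]]|none] := pselect (exists n b y1,
        dist y y1 < r /\ dist (h n b) y1 < r).
      exists n, b => y' yy'.
      have [by'|by'] := lerP r (dist (h n b) y'); last exact: f_near.
      have [yfar|yfar] := pselect (far y').
        by rewrite f_far //; apply: tube_far.
      exfalso; apply: yfar => n' b'.
      have [//|by2] := lerP r (dist (h n' b') y').
      have [|? ?] := center_uniq by2 (_ : dist (h n b) y' < 3 * r).
        have := dist_triangle (h n b) y1 y'; have := dist_triangle y1 y y'.
        by rewrite (dist_sym y1 y); lra.
      by subst n' b'; move: by'; rewrite leNgt by2.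
    exists 0%N, x0 => y' yy'.
    have yfar : far y'.
      move=> n' b'; have [//|by2] := lerP r (dist (h n' b') y').
      by case: none; exists n', b', y'.
    by rewrite f_far //; exact: tube_far.
  have ye : f y = tube (h n b) (kap n b) y by apply: loc; rewrite distxx.
  have := @tube_continuous (h n b) (kap n b) m c a y.
  rewrite /continuous_at ye; apply: cvg_trans.
  apply: near_eq_cvg; apply/nbhs_distP; exists r => // y' yy'.
  by rewrite loc.
Qed.

End hedgehog_power.

(** * Compactness of the power and transfer of its topology *)

Section product_topology.
Import ArrowAsProduct.

(** [K] is [X] with the topology pulled back along [f], a copy of [range f], and the bijection is
    the identity. *)
Lemma compact_condensation (X T : topologicalType) (f : X -> T) :
  hausdorff_space T -> injective f -> continuous f -> compact (range f) ->
  exists (K : topologicalType) (g : X -> K),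
    [/\ hausdorff_space K, compact [set: K], continuous g & bijective g].
Proof.
move=> Th fi fc fK.
pose K : topologicalType := initial_topology f.
pose fK' : K -> T := f.
have fKc : continuous fK' by exact: initial_continuous.
exists K, (id : X -> K); split; last by exists id.
- move=> x y xy; apply: fi; apply: Th => A B.
  move=> /fKc xA /fKc yB.
  by have [z [zA zB]] := xy _ _ xA yB; exists (f z).
- move=> F FF _.
  have [|y [[x _ <-] clx]] := fK (fK' @ F) _ _.
    by apply: (@filterS _ F _ setT); [move=> x _; exists x|exact: filterT].
  exists x; split=> // A B FA [_ [[C oC <-] Cx CB]].
  have [|z [[u Au <-] Cu]] := clx (fK' @` A) C _ (open_nbhs_nbhs (conj oC Cx)).
    by apply: (@filterS _ F _ A) => // u Au; exists u.
  by exists u; split => //; apply: CB.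
- move=> x A [_ [[C oC <-] Cx CA]].
  apply: (@filterS _ _ _ (f @^-1` C)) => //.
  by apply: fc; apply: open_nbhs_nbhs.
Qed.

Lemma hausdorff_real_power (R : realType) (J : eqType) :
  hausdorff_space (J -> R).
Proof. by apply: hausdorff_product => j; exact: Rhausdorff. Qed.

Lemma continuous_to_power (X : topologicalType) (R : realType) (J : eqType)
    (f : X -> (J -> R)) :
  (forall j, continuous (fun x => f x j)) -> continuous f.
Proof.
move=> fc x; apply/cvg_sup => j U [V [[W oW <-] Wfx WU]]; apply: (filterS WU).
by apply: (fc j x W); exact: open_nbhs_nbhs.
Qed.

(** Having at most one nonzero value means that products of values at distinct spines vanish. These
    are closed conditions inside a Tychonoff cube. *)
Lemma compact_hedgehog_power (R : realType) (X : metricType R) :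
  compact [set z : nat * nat * X -> R |
    hedgehog_power (fun m c a => z (m, c, a))].
Proof.
pose J : eqType := (nat * nat * X)%type.
pose cube : set (J -> R) := [set z | forall j, `[0, 1]%classic (z j)].
have cubeK : compact cube.
  by apply: (@tychonoff J (fun=> R) (fun=> `[0, 1]%classic)) => _;
    exact: segment_compact.
have Jc (j : J) : continuous (fun z : J -> R => z j) by exact: proj_continuous.
rewrite (_ : mkset _ = cube `&` \bigcap_(p in [set p : nat * nat * X * X |
    p.1.2 <> p.2]) ((fun z : J -> R => z p.1 * z (p.1.1, p.2)) @^-1` [set 0])).
  apply: compact_closedI cubeK _; apply: closed_bigI => p _.
  apply: preimage_closed; last exact: closed_eq.
  by move=> z _; exact: (cvgM (Jc p.1 z) (Jc (p.1.1, p.2) z)).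
apply/seteqP; split=> z.
  move=> zH; split=> [[[m c] a]|[[[m c] a] b] /= ab].
    by rewrite /= in_itv; exact: (zH m c).1.
  have [-> |/eqP za] := eqVneq (z (m, c, a)) 0; first by rewrite mul0r.
  have [-> |/eqP zb] := eqVneq (z (m, c, b)) 0; first by rewrite mulr0.
  by case: ab; exact: (zH m c).2 za zb.
move=> [z01 zu] m c; split=> [a|a b /eqP za /eqP zb].
  by have := z01 (m, c, a); rewrite /= in_itv.
apply: contrapT => ab; have /eqP := zu (m, c, a, b) ab.
by rewrite mulf_eq0 (negPf za) (negPf zb).
Qed.

Lemma hedgehog_power_compactum (R : realType) (X : metricType R)
    (f : X -> nat -> nat -> X -> R) :
  injective f -> range f = @hedgehog_power R X ->
  (forall m c a, continuous (fun y => f y m c a)) ->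
  exists (K : topologicalType) (g : X -> K),
    [/\ hausdorff_space K, compact [set: K], continuous g & bijective g].
Proof.
move=> f_inj f_range f_cont; pose J : eqType := (nat * nat * X)%type.
pose F x : J -> R := fun j => f x j.1.1 j.1.2 j.2.
apply: (@compact_condensation X _ F).
- exact: hausdorff_real_power.
- move=> x y exy; apply: f_inj; apply/funext => m; apply/funext => c.
  by apply/funext => a; exact: (congr1 (@^~ (m, c, a)) exy).
- by apply: continuous_to_power => -[[m c] a]; exact: f_cont.
have <- : [set z | hedgehog_power (fun m c a => z (m, c, a))] = range F.
  apply/seteqP; split=> [z zH|_ [x _ <-]] /=.
    have : range f (fun m c a => z (m, c, a)) by rewrite f_range.
    move=> [x _ fx]; exists x => //; apply/funext => -[[m c] a].
    by rewrite /F /= fx.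
  by rewrite -f_range; exists x.
exact: compact_hedgehog_power.
Qed.

End product_topology.

Theorem corollary3p2 (L : Type) (L_infinite : infinite_set [set: L])
    (L_power_aleph0 : [set: L] #= [set: nat -> L])
    (R : realType) (X : metricType R) (X_weight : has_weight X L) :
  exists (K : topologicalType) (f : X -> K),
    [/\ hausdorff_space K, compact [set: K], continuous f & bijective f].
Proof.
have XL := card_le_weight L_power_aleph0 X_weight.
have [r [g [r0 g_inj g_sep]]] := weight_le_separated L_power_aleph0 X_weight.
have LX : [set: L] #<= [set: X] by exact: (inj_card_leT g_inj).
have powL : [set: nat -> L] #<= [set: L].
  by move: L_power_aleph0; rewrite card_eq_le => /andP[].
have powX : [set: nat -> X] #<= [set: X].
  exact: card_le_trans (card_le_pow powL XL) LX.
have natL : [set: nat] #<= [set: L] by apply/infiniteP.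
have natX := card_le_trans natL LX.
(* The separated family indexed by [L] is reindexed by pairs of a stage and a point of [X]. *)
have [e e_inj] := card_leT_inj
  (card_le_trans (card_le_prod powX natX (card_lexx _)) XL).
pose h n a := g (e (n, a)).
have [x0 _] : [set: X] !=set0.
  by have [u _] := card_leT_inj natX; exists (u 0%N).
have [phi [phi_cont phi_H phi_sep]] := hedgehog_embedding X.
have h_inj n a n' a' : h n a = h n' a' -> n = n' /\ a = a'.
  by move=> /g_inj/e_inj[-> ->].
have h_sep n a n' a' :
    h n a <> h n' a' -> 4 * (r / 4) <= dist (h n a) (h n' a').
  move=> hh; have : r <= dist (h n a) (h n' a').
    by apply: g_sep => ee; apply: hh; rewrite /h ee.
  by lra.
have r40 : 0 < r / 4 by lra.
have [f [f_inj f_range f_cont]] := hedgehog_power_condensation x0 phi_cont phi_H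
  phi_sep r40 h_inj h_sep (card_hedgehog_power powX natX).
exact: hedgehog_power_compactum f_inj f_range f_cont.
Qed.
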